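(* Let $M$ be a Garside monoid with length-preserving relations and fundamental element $\delta$, and let $G$ be its group of fractions, assumed noncommutative. Let $\ell$, $\ell_{\mathrm G}$, $\ell_{\mathrm R}$ be the minimal, greedy and rational lengths on $G$. For each $x\in G$: (1) If $x\in M$, then $\ell_{\mathrm G}(x)=\ell_{\mathrm R}(x)=\ell(x)$. (2) If $x\in M^{-1}$, then $\ell_{\mathrm R}(x)=\ell(x)$. (3) $\ell(x)\le \ell_{\mathrm R}(x)\le \ell_{\mathrm G}(x)\le (2\ell(\delta)-1)\,\ell(x)$. (4) $\ell_{\mathrm R}(x)\le (\ell(\delta)-1)\,\ell(x)$. Moreover, the bounds in (3) cannot be improved, i.e. the constant factors are optimal: there is no constant $c>1$ such that $c\,\ell(x)\le\ell_{\mathrm R}(x)$ for all $x\in G$, no constant $c>1$ such that $c\,\ell_{\mathrm R}(x)\le \ell_{\mathrm G}(x)$ for all $x\in G$, and no constant $C<2\ell(\delta)-1$ such that $\ell_{\mathrm G}(x)\le C\,\ell(x)$ for all $x\in G$.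
   Context: Garside monoids. Let $M$ be a cancellative monoid. An element $x\ne 1$ of $M$ is an atom if $x=ab$ with $a,b\in M$ implies $a=1$ or $b=1$. $M$ is atomic if it is generated by its atoms and for each $a\in M$ the maximum number of atoms in an expression of $a$ as a product of atoms exists. $a$ is a left divisor (right divisor) of $b$ if $ac=b$ ($ca=b$) for some $c\in M$. A Garside element of $M$ is an element whose left divisors and right divisors coincide and include all atoms. $M$ is a Garside monoid if it is atomic, has a Garside element, and any $a,b\in M$ have a greatest common divisor $a\wedge b$ and a least common multiple $a\vee b$ with respect to left divisibility. The complement $a\setminus b$ is the unique $c\in M$ with $ac=a\vee b$. The set $S$ of simple elements is the closure of the set of atoms under complement and least common multiple. The fundamental element $\delta$ is the least common multiple of all elements of $S$ (assumed to exist); it is the least Garside element. $G$ is the group of fractions of $M$, with $M\subseteq G$; $M^{-1}=\{u^{-1}:u\in M\}$. ''Length-preserving relations'' means that $M$ is presented, with its atoms as generators, by relations each of which equates two words of the same length. Greedy normal form. For $x\in M$, put $x_1=x$, $s_i=\delta\wedge x_i$, $x_{i+1}=s_i^{-1}x_i$, and let $n$ be minimal with $x_{n+1}=1$; then $x=s_1\cdots s_n$. If $k\ge0$ is maximal with $s_1=\dots=s_k=\delta$, and $p_i=s_{k+i}$ for $i=1,\dots,r$, $r=n-k$, the greedy normal form of $x$ is $x=\delta^kp_1\cdots p_r$. For $x\in G\setminus M$, take the maximal integer $k$ with $x=\delta^ks$ for some $s\in M$; if $s=p_1\cdots p_r$ is the greedy normal form of $s$, then the greedy normal form of $x$ is $\delta^kp_1\cdots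 p_r$ (here $k<0$). Rational normal form. For each $x\in G$ there is a unique pair $(u,v)\in M\times M$ with $x=u^{-1}v$ and $u\wedge v=1$. If $s_1\cdots s_k$ and $p_1\cdots p_l$ are the greedy normal forms of $u$ and $v$ (with each power of $\delta$ written out as separate simple factors $\delta$; $k=0$ or $l=0$ allowed), the rational normal form of $x$ is $(s_1\cdots s_k)^{-1}(p_1\cdots p_l)$. Lengths. Let $A$ be the set of atoms. $\ell(x)$ is the minimal length of an expression of $x\in G$ as a product of elements of $A^{\pm1}$. $\ell_{\mathrm G}(x)$ is the sum of the minimal lengths of all simple elements (including inverted ones) in the greedy normal form of $x$: if it is $\delta^ks_1\cdots s_r$, then $\ell_{\mathrm G}(x)=|k|\ell(\delta)+\ell(s_1)+\dots+\ell(s_r)$. $\ell_{\mathrm R}(x)$ is the sum of the minimal lengths of all simple elements (including inverted ones) in the rational normal form: if it is $(s_1\cdots s_k)^{-1}p_1\cdots p_l$, then $\ell_{\mathrm R}(x)=\sum_{i=1}^k\ell(s_i)+\sum_{j=1}^l\ell(p_j)$. *)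

(* Defs.v *)
From HB Require Import structures.
From mathcomp Require Import all_boot all_order all_algebra.
From mathcomp Require Import boolp classical_sets reals.

Set Implicit Arguments.
Unset Strict Implicit.
Unset Printing Implicit Defensive.

Local Open Scope classical_set_scope.
Local Open Scope group_scope.

Section GarsideMonoid.
Variable M : monoidType.
Implicit Types (a b c x : M) (w : seq M) (Rel : seq M -> seq M -> Prop).

Definition cancellative : Prop :=
  (forall a b c, a * b = a * c -> b = c) /\ (forall a b c, b * a = c * a -> b = c).

Definition atom x : Prop :=
  x <> 1 /\ forall a b, x = a * b -> a = 1 \/ b = 1.

Definition atom_word w : Prop := forall a, a \in w -> atom a.

(* [w] is an expression of [x] as a product of atoms. *)
Definition atom_expr x w : Prop := atom_word w /\ x = \prod_(a <- w) a.

Definition generated_by_atoms : Prop := forall x, exists w, atom_expr x w.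

Definition atomic : Prop :=
  generated_by_atoms /\
  forall x, exists n,
    (exists2 w, atom_expr x w & size w = n) /\
    (forall w, atom_expr x w -> (size w <= n)%N).

Definition ldvd a b : Prop := exists c, a * c = b.
Definition rdvd a b : Prop := exists c, c * a = b.

(* gcd and lcm with respect to left divisibility *)
Definition is_gcd a b d : Prop :=
  [/\ ldvd d a, ldvd d b & forall c, ldvd c a -> ldvd c b -> ldvd c d].
Definition is_lcm a b m : Prop :=
  [/\ ldvd a m, ldvd b m & forall c, ldvd a c -> ldvd b c -> ldvd m c].

Definition is_complement a b c : Prop := is_lcm a b (a * c).

Definition garside_element g : Prop :=
  (forall x, ldvd x g <-> rdvd x g) /\ (forall x, atom x -> ldvd x g).

Definition garside_monoid : Prop :=
  [/\ cancellative, atomic, exists g, garside_element g,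
      forall a b, exists d, is_gcd a b d & forall a b, exists m, is_lcm a b m].

Inductive simple : M -> Prop :=
| simple_atom a : atom a -> simple a
| simple_complement a b c : simple a -> simple b -> is_complement a b c -> simple c
| simple_lcm a b c : simple a -> simple b -> is_lcm a b c -> simple c.

(* [d] is the lcm of all simple elements, and it is the least Garside element.
   With infinitely many atoms the first clause alone does not make [d] a Garside
   element, so the second one is not redundant. *)
Definition fundamental d : Prop :=
  [/\ (forall s, simple s -> ldvd s d) /\
      (forall m, (forall s, simple s -> ldvd s m) -> ldvd d m),
      garside_element d & forall g, garside_element g -> ldvd d g].

(* The monoid congruence on words generated by [Rel]. *)
Inductive word_cong Rel : seq M -> seq M -> Prop :=
| word_cong_step (u r s v : seq M) : Rel r s -> word_cong Rel (u ++ r ++ v) (u ++ s ++ v)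
| word_cong_refl w : word_cong Rel w w
| word_cong_sym w w' : word_cong Rel w w' -> word_cong Rel w' w
| word_cong_trans w w' w'' :
    word_cong Rel w w' -> word_cong Rel w' w'' -> word_cong Rel w w''.

(* [M] is presented by the relations [Rel], with its atoms as generators. *)
Definition atom_presentation Rel : Prop :=
  [/\ forall r s, Rel r s -> atom_word r /\ atom_word s,
      generated_by_atoms &
      forall w w', atom_word w -> atom_word w' ->
        (\prod_(a <- w) a = \prod_(a <- w') a <-> word_cong Rel w w')].

Definition length_preserving : Prop :=
  exists2 Rel, atom_presentation Rel & forall r s, Rel r s -> size r = size s.

(* The sequence s_1, ..., s_n given by s_i = delta /\ x_i, x_i = s_i x_{i+1},
   starting at x_1 = x and stopping as soon as x_{n+1} = 1. *)
Inductive greedy_factors (delta : M) : M -> seq M -> Prop :=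
| greedy_factors_nil : greedy_factors delta 1 [::]
| greedy_factors_cons x s x' l :
    x <> 1 -> is_gcd delta x s -> x = s * x' ->
    greedy_factors delta x' l -> greedy_factors delta x (s :: l).

(* [x = delta ^+ k * p_1 * ... * p_r] is the greedy normal form of [x] in [M]. *)
Definition monoid_greedy_nf (delta x : M) (k : nat) (p : seq M) : Prop :=
  greedy_factors delta x (nseq k delta ++ p) /\ ohead p <> Some delta.

End GarsideMonoid.

Arguments length_preserving M : clear implicits.
Arguments garside_monoid M : clear implicits.

Definition zexpg (G : groupType) (x : G) (k : int) : G :=
  match k with Posz n => x ^+ n | Negz n => x ^- n.+1 end.

Section GroupOfFractions.
Variables (M : monoidType) (G : groupType) (iota : UMagmaMorphism.type M G).

(* [iota] identifies [M] with a submonoid of its group of fractions [G]. *)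
Definition group_of_fractions : Prop :=
  injective iota /\ forall x, exists u v, x = (iota u)^-1 * iota v.

Definition in_monoid (x : G) : Prop := exists m, x = iota m.
Definition in_monoid_inv (x : G) : Prop := exists m, x = (iota m)^-1.

Definition atom_or_inv (g : G) : Prop :=
  exists2 a, atom a & g = iota a \/ g = (iota a)^-1.

Definition expr_length (x : G) (n : nat) : Prop :=
  exists w : seq G, [/\ forall g, g \in w -> atom_or_inv g,
                        x = \prod_(g <- w) g & size w = n].

Definition len (x : G) : nat :=
  xget 0%N [set n | expr_length x n /\ forall m, expr_length x m -> (n <= m)%N].

Variable delta : M.

Definition delta_factor (x : G) (k : int) (s : M) : Prop :=
  x = zexpg (iota delta) k * iota s.

(* [(k, p)] stands for delta^k p_1 ... p_r. *)
Definition is_greedy_nf (x : G) (f : int * seq M) : Prop :=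
  let: (k, p) := f in
  (exists m n, [/\ x = iota m, k = Posz n & monoid_greedy_nf delta m n p]) \/
  (~ in_monoid x /\
   exists s, [/\ delta_factor x k s,
                 forall k' s', delta_factor x k' s' -> (k' <= k)%R &
                 greedy_factors delta s p]).

Definition greedy_nf (x : G) : int * seq M :=
  xget (Posz 0, [::]) [set f | is_greedy_nf x f].

Definition lenG (x : G) : nat :=
  let: (k, p) := greedy_nf x in
  (`|k| * len (iota delta) + \sum_(s <- p) len (iota s))%N.

(* [(s, p)] stands for (s_1 ... s_k)^-1 p_1 ... p_l. *)
Definition is_rational_nf (x : G) (f : seq M * seq M) : Prop :=
  exists u v, [/\ x = (iota u)^-1 * iota v, is_gcd u v 1,
                  greedy_factors delta u f.1 & greedy_factors delta v f.2].

Definition rational_nf (x : G) : seq M * seq M :=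
  xget ([::], [::]) [set f | is_rational_nf x f].

Definition lenR (x : G) : nat :=
  let: (s, p) := rational_nf x in
  (\sum_(t <- s) len (iota t) + \sum_(t <- p) len (iota t))%N.

End GroupOfFractions.

(* Main.v *)
Require Import Defs.
From mathcomp Require Import all_boot all_order all_algebra.
From mathcomp Require Import boolp classical_sets reals.
From mathcomp Require Import zify.

(** The relations preserve length, so all atomic expressions of an element [m] of
    the monoid have one size, its degree, and the degree is additive.  Two ways of
    pushing the inverse atoms of a word of [G] to the left then give everything.
    Let [L] be the degree of [delta].

    Every atom [a] divides [delta] on both sides, so [a^-1 = delta^-1 * c] with
    [c] of degree [L - 1], and conjugation by [delta] preserves the monoid.  Hence
    a word with [n] negative and [p] positive letters equals [delta ^- n * s] with
    [s] of degree [n * (L - 1) + p] ([letters_delta_fraction]).  For a word that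
    represents [m] in the monoid this forces the degree of [m] to be [p - n], so
    the minimal length of [m] and of [m^-1] is the degree of [m].  All three
    lengths can then be read off from degrees: the rational length of
    [u^-1 * v], with [u] and [v] coprime, is the sum of the degrees of [u] and [v];
    the greedy length of [delta ^- n * s], with [n] minimal, is [n * L] plus the
    degree of [s].

    As a coprime fraction is a reduction of every other fraction for the same
    element, the rational length is at most the sum of the degrees of numerator
    and denominator of any fraction; applied to [delta ^- n * s], this gives
    the comparison with the greedy length.  In the bound for the greedy length,
    the minimal exponent is at most the number of negative letters, and the
    extreme case is the word of the single letter [a^-1], whose greedy normal
    form [delta^-1 * c] has length [2 * L - 1]; the two other constants are
    attained at [delta], whose three lengths agree.

    The sharper bound for the rational length comes from a symmetric way of
    reading a word ([letters_proper_fraction]).  When [t] and [b] are nontrivial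
    divisors of [delta], completing both to [delta = c * t = t' * b] gives
    [t * b^-1 = c^-1 * t'].  So an inverse letter can cross a product of proper
    divisors of [delta] without changing the number of factors, and the word
    becomes a fraction with one proper divisor of [delta], of degree at most
    [L - 1], for each letter.  This needs the atoms to be proper divisors, that is
    [1 < L]: otherwise [delta] would be the only atom and [G] commutative. *)

Set Implicit Arguments.
Unset Strict Implicit.
Unset Printing Implicit Defensive.

Import Order.TTheory GRing.Theory Num.Theory.

Local Open Scope ring_scope.

(** * The degree of an element of a monoid with length-preserving relations *)

Section Degree.
Local Open Scope group_scope.

Variable M : monoidType.
Implicit Types (a b c x y : M) (w : seq M).

(** The choice of the expression is immaterial, by [atom_expr_size]. *)
Definition degree x : nat := size (xget [::] [set w | atom_expr x w]%classic).

Hypothesis lenpres : length_preserving M.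

Lemma atom_expr_exists x : exists w, atom_expr x w.
Proof. by case: lenpres => Rel [_ gen _] _; apply: gen. Qed.

(** The congruence generated by relations between words of equal length only
    identifies words of equal length. *)
Lemma atom_expr_size x w w' :
  atom_expr x w -> atom_expr x w' -> size w = size w'.
Proof.
case: lenpres => Rel [_ _ cong] relsize [aw ->] [aw' /(cong _ _ aw aw')].
elim=> {w w' aw aw'} [u r s v /relsize eqrs | w | w w' _ -> |] //.
  by rewrite !size_cat eqrs.
by move=> w w' w'' _ -> _ ->.
Qed.

Lemma degreeE x w : atom_expr x w -> degree x = size w.
Proof.
move=> xw; apply: (@atom_expr_size x) => //.
exact: (xgetPex [::] (P := [set w | atom_expr x w]%classic) (atom_expr_exists x)).
Qed.

Lemma degree1 : degree 1 = 0%N.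
Proof. by apply: (@degreeE 1 [::]); split; rewrite ?big_nil. Qed.

Lemma degreeM x y : degree (x * y) = (degree x + degree y)%N.
Proof.
have [[w [aw xw]] [w' [aw' yw']]] := (atom_expr_exists x, atom_expr_exists y).
have aww' : atom_word (w ++ w').
  by move=> a; rewrite mem_cat => /orP[/aw|/aw'].
rewrite (@degreeE x w) // (@degreeE y w') // -size_cat; apply: degreeE.
by split=> //; rewrite big_cat -xw -yw'.
Qed.

Lemma degree_atom a : atom a -> degree a = 1%N.
Proof.
move=> aa; apply: (@degreeE a [:: a]); split; rewrite ?big_seq1 //.
by move=> b; rewrite inE => /eqP->.
Qed.

Lemma degreeX x n : degree (x ^+ n) = (n * degree x)%N.
Proof.
by elim: n => [|n IHn]; rewrite ?expg0 ?degree1 // expgS degreeM IHn mulSn.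
Qed.

Lemma degree_prod w : degree (\prod_(s <- w) s) = (\sum_(s <- w) degree s)%N.
Proof.
by elim: w => [|s w IHw]; rewrite ?big_nil ?degree1 // !big_cons degreeM IHw.
Qed.

Lemma degree_eq0 x : degree x = 0%N -> x = 1.
Proof.
have [w xw] := atom_expr_exists x; rewrite (degreeE xw) => /size0nil w0.
by case: xw => _; rewrite w0 big_nil.
Qed.

Lemma degree_gt0 x : x <> 1 -> (0 < degree x)%N.
Proof. by rewrite lt0n => x1; apply/eqP => /degree_eq0. Qed.

Lemma left_unit_eq1 x y : x * y = 1 -> x = 1.
Proof.
move=> xy; apply: degree_eq0.
by move: degree1; rewrite -xy degreeM; lia.
Qed.

Lemma atom_ldvd_exists x : x <> 1 -> exists2 a, atom a & ldvd a x.
Proof.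
move=> x1; have [[|a w] [aw xw]] := atom_expr_exists x.
  by case: x1; rewrite xw big_nil.
exists a; first by apply: aw; rewrite inE eqxx.
by exists (\prod_(b <- w) b); rewrite xw big_cons.
Qed.

Lemma atom_ind (P : M -> Prop) :
  P 1 -> (forall a x, atom a -> P x -> P (a * x)) -> forall x, P x.
Proof.
move=> P1 PM x; have [w [aw ->]] := atom_expr_exists x.
elim: w aw => [|a w IHw] aw; rewrite ?big_nil // big_cons.
apply: PM; first by apply: aw; rewrite inE eqxx.
by apply: IHw => b bw; apply: aw; rewrite inE bw orbT.
Qed.

End Degree.

(** * Greatest common divisors, Garside elements and greedy factors *)

Section Garside.
Local Open Scope group_scope.

Variables (M : monoidType) (delta : M).
Implicit Types (a b c d s t u v x y : M) (w : seq M).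

Hypothesis lenpres : length_preserving M.
Hypothesis mulIl : forall a b c, a * b = a * c -> b = c.
Hypothesis mulIr : forall a b c, b * a = c * a -> b = c.
Hypothesis gcd_exists : forall a b, exists d, is_gcd a b d.
Hypothesis delta_garside : garside_element delta.

Local Notation deg := (@degree M).

(** A common divisor [c] of [u] and [v] makes [d * c] a divisor of the gcd [d]. *)
Lemma coprime_of_gcd d u v : is_gcd (d * u) (d * v) d -> is_gcd u v 1.
Proof.
case=> _ _ dmax; split; [by exists u; rewrite mul1g | by exists v; rewrite mul1g |].
move=> c [u' eu] [v' ev].
have [e ede] : ldvd (d * c) d.
  by apply: dmax; [exists u' | exists v']; rewrite -mulgA ?eu ?ev.
by exists e; apply: (@mulIl d); rewrite mulgA ede mulg1.
Qed.

(** Left multiplication by [q] preserves gcds, so [q] is the gcd of [q * u] and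
    [q * v]. *)
Lemma ldvd_coprime_mul p q u v :
  is_gcd u v 1 -> ldvd p (q * u) -> ldvd p (q * v) -> ldvd p q.
Proof.
case=> _ _ uv1 pu pv; have [g [[gu eu] [gv ev] gmax]] := gcd_exists (q * u) (q * v).
have [e qe] : ldvd q g by apply: gmax; [exists u | exists v].
have [f ef] : ldvd e 1.
  by apply: uv1; [exists gu | exists gv]; apply: (@mulIl q); rewrite mulgA qe.
by rewrite -[q]mulg1 -(left_unit_eq1 lenpres ef) qe; apply: gmax.
Qed.

(** For an atom [a], take [q * a = delta] and then [p * q = delta], which exists
    because left and right divisors of [delta] coincide: then
    [delta * a = p * q * a = p * delta].  The atoms generate [M]. *)
Lemma delta_mul_swap x : exists y, delta * x = y * delta.
Proof.
elim/(atom_ind lenpres): x => [|a x aa [y xy]]; first by exists 1; rewrite mulg1 mul1g.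
case: delta_garside => lrdvd /(_ a aa)/lrdvd [q qa].
have [p pq] : rdvd q delta by apply/lrdvd; exists a.
by exists (p * y); rewrite -mulgA -xy mulgA -{1}pq -(mulgA p) qa mulgA.
Qed.

Lemma delta_atom_factor a : atom a -> exists c, c * a = delta.
Proof. by case: delta_garside => lrdvd atoms /atoms/lrdvd. Qed.

(** A nontrivial element shares an atom with [delta], so each greedy step strictly
    lowers the degree. *)
Lemma greedy_factors_exists x : exists w, greedy_factors delta x w.
Proof.
have [n] := ubnP (deg x); elim: n x => // n IHn x; rewrite ltnS => degx.
have [-> | x1] := pselect (x = 1); first by exists [::]; constructor.
have [s [sdelta [x' sx'] smax]] := gcd_exists delta x.
have [a aa ax] := atom_ldvd_exists lenpres x1.
have [b ab] : ldvd a s by apply: smax => //; case: delta_garside => _; apply.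
have degs : (0 < deg s)%N by rewrite -ab degreeM // degree_atom.
have [|w xw] := IHn x'; first by move: degx; rewrite -sx' degreeM //; lia.
by exists (s :: w); apply: (greedy_factors_cons x1 _ (esym sx') xw); split=> //; exists x'.
Qed.

Lemma greedy_factors_prod x w : greedy_factors delta x w -> x = \prod_(s <- w) s.
Proof.
elim=> [|{}x s x' {}w _ _ -> _ IHw]; first by rewrite big_nil.
by rewrite big_cons -IHw.
Qed.

Lemma greedy_factors_degree x w :
  greedy_factors delta x w -> (\sum_(s <- w) deg s)%N = deg x.
Proof. by move=> /greedy_factors_prod->; rewrite degree_prod. Qed.

Lemma monoid_greedy_nf_exists x : exists k p, monoid_greedy_nf delta x k p.
Proof.
have [w xw] := greedy_factors_exists x.
suff [k [p [wE hp]]] : exists k p, w = nseq k delta ++ p /\ ohead p <> Some delta.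
  by exists k, p; split; rewrite -?wE.
elim: w {xw} => [|s w [k [p [-> hp]]]]; first by exists 0%N, [::].
have [-> | sd] := eqVneq s delta; first by exists k.+1, p.
by exists 0%N, (s :: nseq k delta ++ p); split=> //= -[/eqP]; rewrite (negPf sd).
Qed.

(** * Moving a proper divisor of [delta] through a product *)

(** As [delta] is a Garside element, these are also its proper right divisors. *)
Definition proper_divisor t := ldvd t delta /\ t <> delta.

Lemma proper_divisorP c t : c * t = delta ->
  (t <> 1 -> proper_divisor c) /\ (c <> 1 -> proper_divisor t).
Proof.
case: delta_garside => lrdvd _ ct; split=> n1; split.
- by exists t.
- by move=> cd; apply: n1; apply: (@mulIl c); rewrite ct mulg1.
- by apply/lrdvd; exists c.
- by move=> td; apply: n1; apply: (@mulIr t); rewrite ct mul1g.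
Qed.

Lemma proper_divisor_degree t : proper_divisor t -> (deg t < deg delta)%N.
Proof.
case=> -[c tc] td; rewrite -tc degreeM // -[X in (X < _)%N]addn0 ltn_add2l.
by apply: degree_gt0 => // c1; apply: td; rewrite -tc c1 mulg1.
Qed.

Definition proper_word w := forall t, t \in w -> proper_divisor t.

Lemma proper_word_cons t w :
  proper_divisor t -> proper_word w -> proper_word (t :: w).
Proof. by move=> ts ws r; rewrite inE => /orP[/eqP->|/ws]. Qed.

Lemma proper_word_rcons t w :
  proper_divisor t -> proper_word w -> proper_word (rcons w t).
Proof. by move=> ts ws r; rewrite mem_rcons inE => /orP[/eqP->|/ws]. Qed.

Lemma proper_word_degree w :
  proper_word w -> (deg (\prod_(t <- w) t) <= (deg delta).-1 * size w)%N.
Proof.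
rewrite degree_prod //; elim: w => [|t w IHw] ws; first by rewrite big_nil.
rewrite big_cons mulnS leq_add //; last first.
  by apply: IHw => s sw; apply: ws; rewrite inE sw orbT.
have /proper_divisor_degree : proper_divisor t by apply: ws; rewrite inE eqxx.
by lia.
Qed.

(** If [t] and [b] are nontrivial, complete both to [delta = c * t = t' * b]:
    neither quotient is [delta], as neither divisor is trivial. *)
Lemma proper_divisor_exchange t b : proper_divisor t -> proper_divisor b ->
  exists c t', [/\ proper_divisor c, proper_divisor t' & c * t = t' * b].
Proof.
case: delta_garside => lrdvd _ ts bs.
have [t1 | t1] := pselect (t = 1).
  by exists b, t; split; rewrite // t1 mulg1 mul1g.
have [b1 | b1] := pselect (b = 1).
  by exists b, t; split; rewrite // b1 mulg1 mul1g.
have [[/lrdvd[c ct] _] [/lrdvd[t' tb] _]] := (ts, bs).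
exists c, t'; split; last by rewrite ct tb.
  by case: (proper_divisorP ct) => + _; apply.
by case: (proper_divisorP tb) => + _; apply.
Qed.

Lemma proper_word_exchange w b : proper_word w -> proper_divisor b ->
  exists c w', [/\ proper_divisor c, proper_word w', size w' = size w &
    c * \prod_(t <- w) t = \prod_(t <- w') t * b].
Proof.
elim/last_ind: w b => [|w t IHw] b ws bs.
  by exists b, [::]; split; rewrite ?big_nil ?mul1g ?mulg1.
have ts : proper_divisor t by apply: ws; rewrite mem_rcons inE eqxx.
have [c [t' [cs ts' ctb]]] := proper_divisor_exchange ts bs.
have [s sw|e [w' [es ws' sz ew]]] := IHw c _ cs.
  by apply: ws; rewrite mem_rcons inE sw orbT.
exists e, (rcons w' t'); split; rewrite ?size_rcons ?sz //.
  exact: proper_word_rcons.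
by rewrite -!cats1 !big_cat !big_seq1 /= mulgA ew -!mulgA ctb.
Qed.

End Garside.

(** * The three lengths on the group of fractions *)

Section Fractions.
Local Open Scope group_scope.

Variables (M : monoidType) (G : groupType) (iota : UMagmaMorphism.type M G).
Variable delta : M.
Implicit Types (a b c d s t u v m : M) (x y g : G) (w : seq G).

Hypothesis lenpres : length_preserving M.
Hypothesis mulIl : forall a b c, a * b = a * c -> b = c.
Hypothesis mulIr : forall a b c, b * a = c * a -> b = c.
Hypothesis gcd_exists : forall a b, exists d, is_gcd a b d.
Hypothesis delta_garside : garside_element delta.
Hypothesis iotaI : injective iota.
Hypothesis fraction : forall x, exists u v, x = (iota u)^-1 * iota v.

Local Notation deg := (@degree M).
Local Notation L := (deg delta).
Local Notation ell := (len iota).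

Lemma iota_prod (r : seq M) : iota (\prod_(s <- r) s) = \prod_(g <- map iota r) g.
Proof. by rewrite gmulf_prod big_map. Qed.

(** Every element of [G] being a left fraction, [u' * u^-1] has the form
    [p^-1 * q], which provides a common left multiple of [u] and [u']. *)
Lemma fraction_eq u v u' v' :
  (iota u)^-1 * iota v = (iota u')^-1 * iota v' ->
  exists p q, p * u = q * u' /\ p * v = q * v'.
Proof.
move=> uvE; have [p [q pq]] := fraction (iota u' * (iota u)^-1).
have pu : iota q * iota u = iota p * iota u'.
  by apply: (mulgI (iota p)^-1); rewrite mulgA -pq mulgVK mulKg.
exists q, p; split; apply: iotaI; rewrite !gmulfM //.
by rewrite -[iota v](mulVKg (iota u)) uvE mulgA pu mulgA mulgK.
Qed.

(** Two fractions for the same element become equal after expansion; a coprime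
    one is then a reduction of the other. *)
Lemma coprime_fraction_reduced u v u0 v0 : is_gcd u0 v0 1 ->
  (iota u)^-1 * iota v = (iota u0)^-1 * iota v0 ->
  exists d, u = d * u0 /\ v = d * v0.
Proof.
move=> uv0 /fraction_eq [p [q [pu pv]]].
have [|||d pd] := @ldvd_coprime_mul M lenpres mulIl gcd_exists p q u0 v0 => //.
- by exists u.
- by exists v.
by exists d; split; apply: (@mulIl p); rewrite mulgA pd.
Qed.

Lemma coprime_fraction_exists x :
  exists u v, x = (iota u)^-1 * iota v /\ is_gcd u v 1.
Proof.
have [u [v ->]] := fraction x.
have [d duv] := gcd_exists u v; case: (duv) => -[u' eu] [v' ev] _.
exists u', v'; split; last by apply: (@coprime_of_gcd M mulIl d); rewrite eu ev.
by rewrite -eu -ev !gmulfM invgM -mulgA mulKg.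
Qed.

(** ** Words in the atoms and their inverses *)

Definition letters w := forall g, g \in w -> atom_or_inv iota g.

Lemma letters_rcons w g : letters (rcons w g) -> letters w /\ atom_or_inv iota g.
Proof.
move=> wg; split=> [h hw|]; apply: wg; rewrite mem_rcons inE ?eqxx //.
by rewrite hw orbT.
Qed.

Lemma letters_cat w w' : letters w -> letters w' -> letters (w ++ w').
Proof. by move=> lw lw' g; rewrite mem_cat => /orP[/lw|/lw']. Qed.

Lemma prodg_rcons w g : \prod_(h <- rcons w g) h = \prod_(h <- w) h * g.
Proof. by rewrite -cats1 big_cat big_seq1. Qed.

(** Replacing each of the [n] inverse atoms [a^-1] of a word by [delta^-1 * c],
    where [delta = c * a], and moving the factors [delta^-1] to the left turns it
    into [delta ^- n * s].  The equation for the degree of [s] is what makes the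
    exponent sum [p - n] of a word depend on its value only. *)
Lemma letters_delta_fraction w : letters w ->
  exists n p s, [/\ (n + p)%N = size w,
    iota delta ^+ n * \prod_(g <- w) g = iota s & (deg s + n = n * L + p)%N].
Proof.
elim/last_ind: w => [_|w g IHw /letters_rcons[lw [a aa ag]]].
  by exists 0%N, 0%N, 1; rewrite big_nil degree1 // mulg1 gmulf1.
rewrite size_rcons prodg_rcons; have [n [p [s [<- es ds]]]] := IHw lw.
case: ag => ->.
  exists n, p.+1, (s * a); rewrite mulgA es -gmulfM; split; [lia | by [] |].
  by rewrite degreeM // (degree_atom lenpres aa); lia.
have [c ca] := delta_atom_factor delta_garside aa.
have [s' ss'] := delta_mul_swap lenpres delta_garside s.
exists n.+1, p, (s' * c); split; first by rewrite addSn.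
  apply: (mulIg (iota a)); rewrite expgS -!mulgA mulVg mulg1 es -!gmulfM.
  by rewrite -mulgA ca ss'.
have: deg (s' * delta) = (L + deg s)%N by rewrite -ss' degreeM.
have: L = (deg c).+1 by rewrite -ca degreeM // (degree_atom lenpres aa) addn1.
by rewrite !degreeM // mulSn; lia.
Qed.

(** ** The minimal length *)

Lemma expr_length_iota m : expr_length iota (iota m) (deg m).
Proof.
have [r mr] := atom_expr_exists lenpres m; case: (mr) => ar mE.
exists (map iota r); split; last by rewrite size_map (degreeE lenpres mr).
  by move=> g /mapP[a /ar aa ->]; exists a => //; left.
by rewrite mE iota_prod.
Qed.

Lemma expr_lengthV x n : expr_length iota x n -> expr_length iota x^-1 n.
Proof.
case=> w [lw -> <-]; exists (rev [seq g^-1 | g <- w]); split; last first.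
- by rewrite size_rev size_map.
- by rewrite -map_rev big_map prodgV revK.
move=> g; rewrite mem_rev => /mapP[h /lw[a aa ah] ->].
by exists a => //; case: ah => ->; [right | left; rewrite invgK].
Qed.

Lemma expr_lengthM x y n k :
  expr_length iota x n -> expr_length iota y k -> expr_length iota (x * y) (n + k).
Proof.
case=> w [lw -> <-] [w' [lw' -> <-]]; exists (w ++ w'); split.
- exact: letters_cat.
- by rewrite big_cat.
- by rewrite size_cat.
Qed.

Lemma expr_length_fraction u v :
  expr_length iota ((iota u)^-1 * iota v) (deg u + deg v).
Proof.
apply: expr_lengthM (expr_length_iota v).
exact: expr_lengthV (expr_length_iota u).
Qed.

Lemma len_spec x :
  expr_length iota x (ell x) /\ forall n, expr_length iota x n -> (ell x <= n)%N.
Proof.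
suff ex : exists n, expr_length iota x n /\
    forall k, expr_length iota x k -> (n <= k)%N by exact: (xgetPex 0%N ex).
have ex : exists n, `[< expr_length iota x n >].
  have [u [v ->]] := fraction x; exists (deg u + deg v)%N; apply/asboolP.
  exact: expr_length_fraction.
case: (ex_minnP ex) => n /asboolP xn nmin; exists n; split=> // k /asboolP.
exact: nmin.
Qed.

(** A word with [n] negative and [p] positive letters that represents [m] satisfies
    [deg m = p - n], so it is not shorter than [deg m]. *)
Lemma len_iota m : ell (iota m) = deg m.
Proof.
have [[w [lw mw sz]] lmin] := len_spec (iota m).
apply/eqP; rewrite eqn_leq lmin ?andTb; last exact: expr_length_iota.
rewrite -sz; have [n [p [s [<- es ds]]]] := letters_delta_fraction lw.
have: deg (delta ^+ n * m) = deg s.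
  by congr deg; apply: iotaI; rewrite -es gmulfM gmulfXn mw.
by rewrite degreeM // degreeX //; lia.
Qed.

Lemma len_iotaV m : ell (iota m)^-1 = deg m.
Proof.
apply/eqP; rewrite eqn_leq; apply/andP; split.
  by have [_] := len_spec (iota m)^-1; apply; apply/expr_lengthV/expr_length_iota.
rewrite -len_iota; have [_] := len_spec (iota m); apply.
rewrite -[X in expr_length _ X _]invgK; apply: expr_lengthV.
by have [] := len_spec (iota m)^-1.
Qed.

(** ** The rational length *)

Lemma greedy_factors_len m r :
  greedy_factors delta m r -> (\sum_(s <- r) ell (iota s))%N = deg m.
Proof.
move=> /(greedy_factors_degree lenpres) <-.
by apply: eq_bigr => s _; apply: len_iota.
Qed.

Lemma lenR_spec x : exists u v,
  [/\ x = (iota u)^-1 * iota v, is_gcd u v 1 & lenR iota delta x = (deg u + deg v)%N].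
Proof.
rewrite /lenR; case E: rational_nf => [r r'].
have: is_rational_nf iota delta x (r, r').
  rewrite -E; apply: (xgetPex _ (P := [set f | is_rational_nf iota delta x f]%classic)).
  have [u [v [xuv uv1]]] := coprime_fraction_exists x.
  have [r1 ur] := greedy_factors_exists lenpres gcd_exists delta_garside u.
  have [r2 vr] := greedy_factors_exists lenpres gcd_exists delta_garside v.
  by exists (r1, r2), u, v.
by case=> u [v [xuv uv1 /greedy_factors_len-> /greedy_factors_len->]]; exists u, v.
Qed.

(** The coprime fraction divides any other one, on both sides of the bar. *)
Lemma lenR_le_fraction u v :
  (lenR iota delta ((iota u)^-1 * iota v) <= deg u + deg v)%N.
Proof.
have [u0 [v0 [uvE uv0 ->]]] := lenR_spec ((iota u)^-1 * iota v).
have [d [-> ->]] := coprime_fraction_reduced uv0 uvE.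
by rewrite !degreeM //; lia.
Qed.

Lemma len_le_lenR x : (ell x <= lenR iota delta x)%N.
Proof.
have [u [v [-> _ ->]]] := lenR_spec x.
by have [_] := len_spec ((iota u)^-1 * iota v); apply; apply: expr_length_fraction.
Qed.

Lemma lenR_iota m : lenR iota delta (iota m) = deg m.
Proof.
apply/eqP; rewrite eqn_leq -{2}len_iota len_le_lenR andbT.
have := lenR_le_fraction 1 m.
by rewrite gmulf1 invg1 mul1g degree1.
Qed.

Lemma lenR_iotaV m : lenR iota delta (iota m)^-1 = deg m.
Proof.
apply/eqP; rewrite eqn_leq -{2}len_iotaV len_le_lenR andbT.
have := lenR_le_fraction m 1.
by rewrite gmulf1 mulg1 degree1 // addn0.
Qed.

(** Reading a word from left to right keeps a fraction with one proper divisor of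
    [delta] in the numerator for each positive letter and one in the denominator
    for each negative letter. *)
Lemma letters_proper_fraction w : (1 < L)%N -> letters w ->
  exists r r', [/\ proper_word delta r, proper_word delta r',
    (size r + size r')%N = size w &
    \prod_(g <- w) g = (iota (\prod_(s <- r) s))^-1 * iota (\prod_(s <- r') s)].
Proof.
move=> L1; elim/last_ind: w => [_|w g IHw /letters_rcons[lw [a aa ag]]].
  by exists [::], [::]; split; rewrite // !big_nil !gmulf1 invg1 mulg1.
rewrite size_rcons prodg_rcons; have [r [r' [pr pr' <- ->]]] := IHw lw.
have pa : proper_divisor delta a.
  split; first by case: delta_garside => _; apply.
  by move=> ad; move: L1; rewrite -ad (degree_atom lenpres aa).
case: ag => ->.
  exists r, (rcons r' a); split=> //; first exact: proper_word_rcons.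
    by rewrite size_rcons addnS.
  by rewrite -mulgA -gmulfM -cats1 big_cat big_seq1.
have [c [r2 [pc pr2 sz cE]]] :=
  proper_word_exchange mulIl mulIr delta_garside pr' pa.
exists (c :: r), r2; split=> //; first exact: proper_word_cons.
  by rewrite sz.
apply: (mulIg (iota a)); rewrite -!mulgA mulVg mulg1 -gmulfM -cE big_cons.
by rewrite !gmulfM invgM -mulgA mulKg.
Qed.

Lemma lenR_le_len x : (1 < L)%N -> (lenR iota delta x <= L.-1 * ell x)%N.
Proof.
move=> L1; have [[w [lw -> <-]] _] := len_spec x.
have [r [r' [pr pr' <- ->]]] := letters_proper_fraction L1 lw.
apply: leq_trans (lenR_le_fraction _ _) _.
by rewrite mulnDr leq_add // proper_word_degree.
Qed.

(** ** The greedy length *)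

Lemma lenG_iota m : lenG iota delta (iota m) = deg m.
Proof.
rewrite /lenG; case E: greedy_nf => [k p].
have: is_greedy_nf iota delta (iota m) (k, p).
  rewrite -E; apply: (xgetPex _ (P := [set f | is_greedy_nf iota delta (iota m) f]%classic)).
  have [n [r mr]] := monoid_greedy_nf_exists lenpres gcd_exists delta_garside m.
  by exists (Posz n, r); left; exists m, n.
case=> [[m' [n [/iotaI <- -> [/greedy_factors_len <- _]]]] | [[]]]; last by exists m.
by rewrite big_cat /= big_nseq iter_addn_0 mulnC.
Qed.

Lemma delta_fraction_exists x : exists n s, x = iota delta ^- n * iota s.
Proof.
have [[w [lw -> _]] _] := len_spec x.
have [n [_ [s [_ es _]]]] := letters_delta_fraction lw.
by exists n, s; rewrite -es mulKg.
Qed.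

(** The largest exponent of [delta] exists because it is the negative of the least
    natural number [n] for which [delta ^+ n * x] lies in the monoid. *)
Lemma greedy_nf_exists x : ~ in_monoid iota x ->
  exists k p, is_greedy_nf iota delta x (k, p).
Proof.
move=> xM.
have ex : exists n, `[< exists s, x = iota delta ^- n * iota s >].
  by have [n xn] := delta_fraction_exists x; exists n; apply/asboolP.
case: (ex_minnP ex) => -[|n] /asboolP[s xs] nmin.
  by case: xM; exists s; rewrite xs invg1 mul1g.
have [p sp] := greedy_factors_exists lenpres gcd_exists delta_garside s.
exists (Negz n), p; right; split=> //; exists s; split=> // -[k|k] s' xs'.
  by case: xM; exists (delta ^+ k * s'); rewrite xs' gmulfM gmulfXn.
have /nmin : `[< exists s, x = iota delta ^- k.+1 * iota s >].
  by apply/asboolP; exists s'.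
by rewrite !NegzE; lia.
Qed.

Lemma lenG_spec x : ~ in_monoid iota x ->
  exists n s, [/\ x = iota delta ^- n * iota s,
    forall n' s', x = iota delta ^- n' * iota s' -> (n <= n')%N &
    lenG iota delta x = (n * L + deg s)%N].
Proof.
move=> xM; rewrite /lenG; case E: greedy_nf => [k p].
have: is_greedy_nf iota delta x (k, p).
  rewrite -E; apply: (xgetPex _ (P := [set f | is_greedy_nf iota delta x f]%classic)).
  by have [k' [p' xkp]] := greedy_nf_exists xM; exists (k', p').
case=> [[m [j [xm _ _]]] | [_ [s [xs kmax /greedy_factors_len->]]]].
  by case: xM; exists m.
rewrite len_iota {E}; case: k xs kmax => k xs kmax.
  by case: xM; exists (delta ^+ k * s); rewrite xs gmulfM gmulfXn.
exists k.+1, s; split=> // -[|n'] s' xs'.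
  by case: xM; exists s'; rewrite xs' invg1 mul1g.
by have := kmax (Negz n') s' xs'; rewrite !NegzE; lia.
Qed.

Lemma lenR_le_lenG x : (lenR iota delta x <= lenG iota delta x)%N.
Proof.
have [[m ->] | xM] := pselect (in_monoid iota x).
  by rewrite lenR_iota lenG_iota.
have [n [s [xs _ ->]]] := lenG_spec xM.
by rewrite xs -gmulfXn -degreeX // lenR_le_fraction.
Qed.

(** The exponent [n] of [delta^-1] is at most the number of negative letters of a
    shortest word, and the degree of the remaining factor is determined by [n]. *)
Lemma lenG_le_len x : (0 < L)%N -> (lenG iota delta x <= (2 * L).-1 * ell x)%N.
Proof.
move=> L0; have [[m ->] | xM] := pselect (in_monoid iota x).
  by rewrite lenG_iota len_iota -{1}[deg m]mul1n leq_mul2r; apply/orP; right; lia.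
have [n [s [xs nmin ->]]] := lenG_spec xM.
have [[w [lw xw <-]] _] := len_spec x.
have [k [p [s' [<- es ds]]]] := letters_delta_fraction lw.
have nk : (n <= k)%N by apply: (nmin k s'); rewrite -es -xw mulKg.
have: deg (delta ^+ (k - n) * s) = deg s'.
  congr deg; apply: iotaI; rewrite -es -xw xs gmulfM gmulfXn mulgA.
  by rewrite expgnFr.
rewrite degreeM // degreeX // => ds'.
have := subnKC nk; move: (k - n)%N ds' => j ds' kE.
by move: ds ds' L0; rewrite -kE => ds ds' L0; nia.
Qed.

(** The normal form is [delta^-1 * c] with [delta = c * a]: the inverse of
    an atom attains the bound of [lenG_le_len]. *)
Lemma lenG_atomV a : atom a -> lenG iota delta (iota a)^-1 = (2 * L).-1.
Proof.
move=> aa; have da := degree_atom lenpres aa.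
have aM : ~ in_monoid iota (iota a)^-1.
  case=> m /(congr1 (fun g => iota a * g)); rewrite mulgV -gmulfM -[1](gmulf1 (s := iota)).
  by move=> /iotaI /esym am; move: (degree1 lenpres); rewrite -am degreeM // da.
have [n [s [xs nmin ->]]] := lenG_spec aM.
have [c' ca] := delta_atom_factor delta_garside aa.
have n1 : (n <= 1)%N.
  apply: (nmin 1%N c'); apply: (mulgI (iota delta)); rewrite expg1 mulVKg.
  by apply: (mulIg (iota a)); rewrite -mulgA mulVg mulg1 -gmulfM ca.
case: n xs nmin n1 => [|[|//]] xs nmin n1.
  by case: aM; exists s; rewrite xs invg1 mul1g.
have: deg (s * a) = deg delta.
  congr deg; apply: iotaI; rewrite gmulfM.
  by rewrite -[iota s](mulVKg (iota delta)) -[in (iota delta)^-1](expg1 (iota delta)) -xs mulgVK.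
by rewrite degreeM // da; lia.
Qed.

(** An atom of degree [deg delta] is [delta] itself, as all atoms divide [delta];
    then [M] would be generated by [delta] alone. *)
Lemma degree_delta_gt1 : (exists x y, x * y <> y * x) -> (1 < L)%N.
Proof.
move=> [x [y xy]]; rewrite ltnNge; apply/negP => L1.
have pow m : exists n, m = delta ^+ n.
  elim/(atom_ind lenpres): m => [|a m aa [n ->]]; first by exists 0%N.
  have [c ac] : ldvd a delta by case: delta_garside => _; apply.
  exists n.+1; rewrite expgS; congr (_ * _); rewrite -ac.
  rewrite [c](@degree_eq0 M lenpres) ?mulg1 //.
  by move: L1; rewrite -ac degreeM // (degree_atom lenpres aa); lia.
have comm m m' : commute (iota m) (iota m').
  have [[n ->] [n' ->]] := (pow m, pow m').
  by rewrite !gmulfXn; apply: commuteX2.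
case: xy; have [[u [v ->]] [u' [v' ->]]] := (fraction x, fraction y).
suff comm' m : commute ((iota u)^-1 * iota v) (iota m).
  by apply: commuteM => //; apply: commuteV.
apply/commute_sym/commuteM; last exact: comm.
exact/commuteV.
Qed.

End Fractions.

Theorem theorem17 (R : realType) (M : monoidType) (G : groupType)
    (iota : UMagmaMorphism.type M G) (delta : M) :
  garside_monoid M -> length_preserving M -> fundamental delta ->
  group_of_fractions iota -> (exists x y : G, (x * y)%g <> (y * x)%g) ->
  let l : G -> nat := len iota in
  let lG : G -> nat := lenG iota delta in
  let lR : G -> nat := lenR iota delta in
  let L : R := (l (iota delta))%:R in
  (forall x : G,
    [/\ in_monoid iota x -> lG x = lR x /\ lR x = l x,
        in_monoid_inv iota x -> lR x = l x,
        [/\ (l x <= lR x)%N, (lR x <= lG x)%N &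
            (lG x)%:R <= (2 * L - 1) * (l x)%:R] &
        (lR x)%:R <= (L - 1) * (l x)%:R]) /\
  [/\ ~ (exists2 c : R, 1 < c & forall x : G, c * (l x)%:R <= (lR x)%:R),
      ~ (exists2 c : R, 1 < c & forall x : G, c * (lR x)%:R <= (lG x)%:R) &
      ~ (exists2 C : R, C < 2 * L - 1 &
           forall x : G, (lG x)%:R <= C * (l x)%:R)].
Proof.
case=> -[mulIl mulIr] _ _ gcds _ lenpres [_ garside _] [iotaI frac] noncomm.
move=> l lG lR L.
have L1 : (1 < degree delta)%N by exact: (degree_delta_gt1 lenpres garside frac noncomm).
have l_iota m : l (iota m) = degree m by exact: (len_iota (delta := delta)).
have lV m : l (iota m)^-1%g = degree m by exact: (len_iotaV (delta := delta)).
have LE : L = (degree delta)%:R by rewrite /L l_iota.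
have lR_iota m : lR (iota m) = degree m by exact: lenR_iota.
have lG_iota m : lG (iota m) = degree m by exact: lenG_iota.
have coef1 : L - 1 = (degree delta).-1%:R by rewrite LE -subn1 natrB //; lia.
have coef2 : 2 * L - 1 = (2 * degree delta).-1%:R.
  by rewrite LE -subn1 natrB ?natrM //; lia.
split=> [x|].
  split.
  - by case=> m ->; rewrite lG_iota lR_iota l_iota.
  - by case=> m ->; rewrite lV; exact: lenR_iotaV.
  - split; [exact: len_le_lenR | exact: lenR_le_lenG |].
    by rewrite coef2 -natrM ler_nat; apply: lenG_le_len => //; lia.
  - by rewrite coef1 -natrM ler_nat; apply: lenR_le_len.
have delta_gt0 : 0 < (degree delta)%:R :> R by rewrite ltr0n; lia.
split.
- case=> c c1 /(_ (iota delta)); rewrite lR_iota l_iota.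
  by rewrite ger_pMl // leNgt c1.
- case=> c c1 /(_ (iota delta)); rewrite lR_iota lG_iota.
  by rewrite ger_pMl // leNgt c1.
have [a aa _] : exists2 a, atom a & ldvd a delta.
  by apply: atom_ldvd_exists => // d1; move: L1; rewrite d1 degree1.
have lGV : lG (iota a)^-1%g = (2 * degree delta).-1 by exact: lenG_atomV.
case=> C; rewrite coef2 => Clt /(_ (iota a)^-1%g).
by rewrite lGV lV (degree_atom lenpres aa) mulr1 leNgt Clt.
Qed.
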